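(* Let $n$ be an odd positive integer. A sequence $S$ in $\mathbb{Z}_n$ is a $U(n)$-extremal sequence for the Gao constant if and only if there exist (not necessarily distinct) primes $p_1,\ldots,p_k$ with $n=p_1p_2\cdots p_k$ (in some order) and integers $b_1,\ldots,b_k$ with $b_i$ coprime to $p_i$ for each $1\le i\le k$, such that $S$ is $U(n)$-equivalent to the sequence $$(b_1,\ p_1b_2,\ p_1p_2b_3,\ \ldots,\ p_1p_2\cdots p_{k-1}b_k,\ \underbrace{0,\ldots,0}_{n-1\text{ times}}).$$
   Context: $\mathbb{Z}_n=\mathbb{Z}/n\mathbb{Z}$ and $U(n)$ is its group of units; integers are identified with their images in $\mathbb{Z}_n$. A sequence is a finite list $(x_1,\ldots,x_l)$ of elements of $\mathbb{Z}_n$ (repetitions allowed); a subsequence is obtained by restricting to a subset of the indices. For $A\subseteq\mathbb{Z}_n$, a subsequence of $(x_1,\ldots,x_l)$ with index set $I$ is an $A$-weighted zero-sum subsequence if $I\ne\emptyset$ and there exist $a_i\in A$ ($i\in I$) with $\sum_{i\in I}a_ix_i=0$. The $A$-weighted Gao constant $E_A(n)$ is the least positive integer $k$ such that every sequence of length $k$ in $\mathbb{Z}_n$ has an $A$-weighted zero-sum subsequence of length $n$. An $A$-extremal sequence for the Gao constant is a sequence in $\mathbb{Z}_n$ of length $E_A(n)-1$ which has no $A$-weighted zero-sum subsequence of length $n$. For a subgroup $A$ of $U(n)$, two sequences $(x_1,\ldots,x_l)$ and $(y_1,\ldots,y_l)$ in $\mathbb{Z}_n$ are $A$-equivalent if there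 exist $c\in U(n)$, a permutation $\sigma$ of $\{1,\ldots,l\}$ and $a_1,\ldots,a_l\in A$ such that $c\,y_{\sigma(i)}=a_ix_i$ for all $1\le i\le l$. *)

(* Defs.v *)
From HB Require Import structures.
From mathcomp Require Import all_boot all_order all_fingroup all_algebra.

Set Implicit Arguments.
Unset Strict Implicit.
Unset Printing Implicit Defensive.

Import GRing.Theory.
Local Open Scope ring_scope.

(* The ring Z/nZ for n >= 1, as residues 'I_n with the library's modular
   operations.  MathComp's 'Z_n is Z/2Z for n = 1, and 'I_1 has no ring
   structure there; here Zmod 1 is the zero ring.  Zmod 0 is a junk value. *)
Definition Zmod (n : nat) : Type := 'I_n.-1.+1.

HB.instance Definition _ (n : nat) := Finite.on (Zmod n).
HB.instance Definition _ (n : nat) := GRing.Zmodule.on (Zmod n).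
HB.instance Definition _ (n : nat) :=
  GRing.Zmodule_isComPzRing.Build (Zmod n)
    (@Zp_mulA _) (@Zp_mulC _) (@Zp_mul1z n.-1) (@Zp_mul_addl _).

(* The units are spelled out because MathComp's unit rings are nontrivial,
   which excludes Zmod 1. *)
Definition U (n : nat) : {set Zmod n} :=
  [set x | [exists y : Zmod n, x * y == 1]].

Definition zero_sum_subseq (n : nat) (A : {set Zmod n}) (s : seq (Zmod n))
    (I : {set 'I_(size s)}) : Prop :=
  I != set0 /\
  exists2 a : 'I_(size s) -> Zmod n,
    forall i, i \in I -> a i \in A &
    \sum_(i in I) a i * s`_i = 0.

Definition has_zero_sum_subseq_of_length (n : nat) (A : {set Zmod n})
    (s : seq (Zmod n)) (m : nat) : Prop :=
  exists2 I : {set 'I_(size s)}, zero_sum_subseq A I & #|I| = m.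

Definition gao_property (n : nat) (A : {set Zmod n}) (k : nat) : Prop :=
  forall s : seq (Zmod n),
    size s = k -> has_zero_sum_subseq_of_length A s n.

(* k = E_A(n).  This is a relation since E_A(n) need not exist for
   arbitrary A (e.g. for A empty). *)
Definition is_gao_constant (n : nat) (A : {set Zmod n}) (k : nat) : Prop :=
  [/\ (0 < k)%N, gao_property A k
    & forall j : nat, (0 < j)%N -> gao_property A j -> (k <= j)%N].

Definition gao_extremal (n : nat) (A : {set Zmod n}) (s : seq (Zmod n)) : Prop :=
  exists k : nat,
    [/\ is_gao_constant A k, size s = (k - 1)%N
      & ~ has_zero_sum_subseq_of_length A s n].

Definition seq_equiv (n : nat) (A : {set Zmod n}) (x y : seq (Zmod n)) : Prop :=
  size x = size y /\
  exists (c : Zmod n) (sigma : {perm 'I_(size x)}) (a : 'I_(size x) -> Zmod n),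
    [/\ c \in U n, forall i, a i \in A
      & forall i, c * y`_(sigma i) = a i * x`_i].

(* With 0-based indices, the i-th entry of the first block is
   p_0 p_1 ... p_(i-1) b_i, reduced mod n. *)
Definition standard_seq (n k : nat) (p : 'I_k -> nat) (b : 'I_k -> int) :
    seq (Zmod n) :=
  [seq ((\prod_(j < k | (j < i)%N) p j)%N%:Z * b i)%:~R | i : 'I_k <- enum 'I_k]
    ++ nseq (n - 1) 0.

(* Main.v *)
(** Work with integer representatives.  If for every prime p dividing the odd
    number n at least two terms are prime to p, the whole sequence is a
    U(n)-weighted zero-sum: modulo a prime power the two terms prime to p absorb
    any residue (this uses p > 2), and the Chinese remainder theorem glues the
    weights.  Hence a sequence of length at least m >= 2 Omega(n) without a
    zero-sum of length m has some prime p | n dividing all its terms but at most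
    one.  Dropping that term and dividing by p passes from n to n/p; iterating
    gives E_{U(n)}(n) <= n + Omega(n), and on a sequence of length
    n + Omega(n) - 1 every step must drop exactly one term, so that the sequence
    is a mere permutation of a standard one.  Conversely, in a standard sequence
    any n terms include a nonzero one, and the first nonzero one chosen,
    p_1...p_(i-1) b_i, is the only one among them not divisible by p_1...p_i. *)
Require Import Defs.
From HB Require Import structures.
From mathcomp Require Import all_boot all_order all_fingroup all_algebra.
From mathcomp Require Import ring zify.

Set Implicit Arguments.
Unset Strict Implicit.
Unset Printing Implicit Defensive.

Import GRing.Theory.
Local Open Scope ring_scope.

(** * Divisibility and coprimality of integers *)

Lemma coprimez_prime (p : nat) (z : int) :
  prime p -> coprimez z p = ~~ (p %| z)%Z.
Proof. by move=> p_prime; rewrite coprimezE dvdzE coprime_sym prime_coprime. Qed.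

Lemma coprimez_prime_exp (p r : nat) (z : int) :
  prime p -> ~~ (p %| z)%Z -> coprimez z (p ^ r)%N.
Proof.
move=> p_prime; rewrite -coprimez_prime // !coprimezE; exact: coprimeXr.
Qed.

Lemma dvdz_prime_mul (p : nat) (y z : int) :
  prime p -> (p %| y * z)%Z = (p %| y)%Z || (p %| z)%Z.
Proof. by move=> p_prime; rewrite !dvdzE abszM; apply: Euclid_dvdM. Qed.

Lemma coprimez_congr (d y z : int) :
  (d %| y - z)%Z -> coprimez y d = coprimez z d.
Proof.
rewrite -eqz_mod_dvd => /eqP eq_yz.
by rewrite /coprimez -gcdz_modl eq_yz gcdz_modl.
Qed.

(** * Weighted zero-sums of integer families *)

Section WeightedZeroSums.

Variables (T : finType).
Implicit Types (n m p : nat) (x : T -> int) (I D E : {set T}).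

Definition weighted_zero_sum n x I : Prop :=
  exists2 a : T -> int, forall i, i \in I -> coprimez (a i) n
    & (n %| \sum_(i in I) a i * x i)%Z.

Definition nonmultiples p x D : {set T} := [set i in D | ~~ (p %| x i)%Z].

(** Two terms prime to [p] suffice: one receives a sign making the sum of all the terms but the
    other prime to [p], and the other, invertible modulo [p ^ r], cancels that sum. All remaining
    weights are 1. *)
Lemma weighted_zero_sum_prime_power p r x I :
  prime p -> odd p -> (1 < #|nonmultiples p x I|)%N ->
  weighted_zero_sum (p ^ r) x I.
Proof.
move=> p_prime p_odd /card_gt1P[i [j []]]; rewrite !inE.
move=> /andP[iI xi] /andP[jI xj] ij.
set c := \sum_(l in I :\ i :\ j) x l.
have [[y k] /= yk] := coprimezP _ _ (coprimez_prime_exp r p_prime xj).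
(* If both signs failed, [p] would divide the difference [2 * x i], which is impossible for [p]
   odd. *)
have [u u1 cu] : exists2 u : int, u = 1 \/ u = -1 & ~~ (p %| c + u * x i)%Z.
  have [cx|cx] := boolP (p %| c + 1 * x i)%Z; last by exists 1; [left|].
  exists (-1); first by right.
  apply/negP => cx'; have := rpredB cx cx'.
  have -> : c + 1 * x i - (c + -1 * x i) = 2 * x i by ring.
  rewrite dvdz_prime_mul // (negPf xi) orbF dvdzE /= dvdn_prime2 //.
  by move=> /eqP p2; rewrite p2 in p_odd.
have y_co : coprimez y (p ^ r)%N.
  by apply/coprimezP; exists (x j, k); rewrite /= -yk mulrC.
(* [y] inverts [x j] modulo [p ^ r], so [v * x j] cancels [c + u * x i]; [v] is prime to [p] because
   both factors are. *)
pose v := - (y * (c + u * x i)).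
exists (fun l => if l == i then u else if l == j then v else 1).
  move=> l _; have [_|_] := eqVneq l i.
    by case: u1 => ->; rewrite ?coprimeNz coprimezE /= coprime1n.
  have [_|_] := eqVneq l j; last by rewrite coprimezE /= coprime1n.
  by rewrite coprimeNz coprimezMl y_co coprimez_prime_exp. 
have jI' : j \in I :\ i by rewrite !inE eq_sym ij.
rewrite (big_setD1 i iI) (big_setD1 j jI') /= !eqxx eq_sym (negPf ij).
rewrite (eq_bigr x) => [|l]; last first.
  by rewrite !inE => /and3P[/negPf-> /negPf-> _]; rewrite mul1r.
rewrite -/c /v.
have -> : u * x i + (- (y * (c + u * x i)) * x j + c)
  = (c + u * x i) * (1 - y * x j) by ring.
by apply: dvdz_mull; rewrite -yk addrAC subrr add0r dvdz_mull.
Qed.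

(** The Chinese remainder theorem is applied to the two weights of each index. *)
Lemma weighted_zero_sum_mul n1 n2 x I :
  coprime n1 n2 -> weighted_zero_sum n1 x I -> weighted_zero_sum n2 x I ->
  weighted_zero_sum (n1 * n2) x I.
Proof.
move=> co12 [a1 a1P s1] [a2 a2P s2].
have co : coprimez n1 n2 by rewrite coprimezE.
pose a i := zchinese n1 n2 (a1 i) (a2 i).
have aE1 i : (n1 %| a i - a1 i)%Z by rewrite -eqz_mod_dvd zchinese_modl.
have aE2 i : (n2 %| a i - a2 i)%Z by rewrite -eqz_mod_dvd zchinese_modr.
have sum_congr (d : int) (b : T -> int) : (forall i, (d %| a i - b i)%Z) ->
  (d %| \sum_(i in I) b i * x i)%Z -> (d %| \sum_(i in I) a i * x i)%Z.
  move=> ab b0; rewrite -(subrK (\sum_(i in I) b i * x i) (\sum_(i in I) a i * x i)).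
  rewrite rpredD // -sumrB rpred_sum // => i _.
  by rewrite -mulrBl dvdz_mulr.
exists a => [i iI|].
  by rewrite PoszM coprimezMr (coprimez_congr (aE1 i)) a1P //
    (coprimez_congr (aE2 i)) a2P.
by rewrite PoszM Gauss_dvdz // (sum_congr _ _ aE1) ?(sum_congr _ _ aE2).
Qed.

(** Strong induction on [n], splitting off the full power of its least prime factor. *)
Lemma weighted_zero_sum_two_nonmultiples n x I :
  odd n ->
  (forall p, prime p -> (p %| n)%N -> (1 < #|nonmultiples p x I|)%N) ->
  weighted_zero_sum n x I.
Proof.
elim/ltn_ind: n => n IH n_odd nP.
have [n1|n_gt1] := leqP n 1.
  have -> : n = 1%N by case: n n1 n_odd {IH nP} => [|[]].
  exists (fun=> 1) => [i _|]; last exact: dvd1z.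
  by rewrite coprimezE /= coprime1n.
have n_gt0 : (0 < n)%N by apply: ltnW.
set p := pdiv n; have p_prime : prime p by apply: pdiv_prime.
have pn : (p %| n)%N by apply: pdiv_dvd.
have p_odd : odd p by apply: dvdn_odd n_odd.
rewrite -(partnC p n_gt0); apply: weighted_zero_sum_mul.
- by rewrite coprime_partC.
- by rewrite p_part; apply: weighted_zero_sum_prime_power; rewrite ?nP.
have n'n : (n`_p^' %| n)%N by apply: dvdn_part.
apply: IH.
- rewrite -{2}(partnC p n_gt0) ltn_Pmull ?part_gt0 // p_part.
  rewrite -[X in (X < _)%N](expn0 p) ltn_exp2l ?prime_gt1 //.
  by rewrite logn_gt0 mem_primes p_prime n_gt0.
- exact: dvdn_odd n_odd.
- by move=> q q_prime qn; apply: nP => //; apply: dvdn_trans n'n.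
Qed.

Lemma exists_subset_card I D m :
  I \subset D -> (#|I| <= m <= #|D|)%N ->
  exists J : {set T}, [/\ I \subset J, J \subset D & #|J| = m].
Proof.
move=> ID; elim: m => [|m IHm] /andP[Im mD].
  by exists I; split=> //; apply/eqP; rewrite -leqn0.
move: Im; rewrite leq_eqVlt => /orP[/eqP<-|Im]; first by exists I.
have [|J [IJ JD Jm]] := IHm; first by rewrite -ltnS Im ltnW.
have /properP[_ [i iD iJ]] : J \proper D by rewrite properEcard JD Jm.
exists (i |: J); split; first exact: subset_trans IJ (subsetUr _ _).
  by rewrite subUset sub1set iD.
by rewrite cardsU1 iJ Jm.
Qed.

Lemma nonmultiplesS p x I D :
  I \subset D -> nonmultiples p x I \subset nonmultiples p x D.
Proof. by move=> ID; apply/subsetP => i; rewrite !inE => /andP[/(subsetP ID)->]. Qed.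

(** Two witnesses are collected for each entry of [ps], whence the factor 2; enlarging the set keeps
    earlier witnesses. *)
Lemma exists_two_nonmultiples (ps : seq nat) x D :
  (forall p, p \in ps -> (1 < #|nonmultiples p x D|)%N) ->
  exists I : {set T}, [/\ I \subset D, (#|I| <= 2 * size ps)%N
    & forall p, p \in ps -> (1 < #|nonmultiples p x I|)%N].
Proof.
elim: ps => [|p ps IH] psP; first by exists set0; rewrite sub0set cards0.
have [q qps|I [ID Isz IP]] := IH; first by apply: psP; rewrite inE qps orbT.
have /card_gt1P[i [j []]] : (1 < #|nonmultiples p x D|)%N by rewrite psP ?mem_head.
rewrite !inE => /andP[iD xi] /andP[jD xj] ij.
exists ([set i; j] :|: I); split.
- by rewrite !subUset !sub1set iD jD.
- rewrite (leq_trans (leq_card_setU _ _)) // cards2 ij /=; lia.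
move=> q; rewrite inE => /orP[/eqP->|/IP Iq].
  by apply/card_gt1P; exists i, j; rewrite !inE !eqxx ?orbT xi xj.
exact: leq_trans Iq (subset_leq_card (nonmultiplesS _ _ (subsetUr _ _))).
Qed.

(** Multiplying the relation by [p] is harmless; the issue is that weights prime to [n] may be
    divisible by [p], which a shift by [n] repairs. *)
Lemma weighted_zero_sum_lift n p x I :
  prime p -> (forall i, i \in I -> (p %| x i)%Z) ->
  weighted_zero_sum n (fun i => (x i %/ p)%Z) I -> weighted_zero_sum (p * n) x I.
Proof.
move=> p_prime px [a aP a0].
(* When [p] divides [a i], it does not divide [n], since [a i] is prime to [n]; so [a i + n] is
   prime to [p]. *)
pose a' i := if (p %| a i)%Z then a i + n else a i.
have aE i : (n %| a' i - a i)%Z.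
  rewrite /a'; case: ifP => _; last by rewrite subrr dvdz0.
  by rewrite addrAC subrr add0r dvdzz.
have nE : (n %| \sum_(i in I) a' i * (x i %/ p)%Z)%Z.
  rewrite -(subrK (\sum_(i in I) a i * (x i %/ p)%Z) (\sum_(i in I) a' i * _)).
  rewrite rpredD // -sumrB rpred_sum // => i _.
  by rewrite -mulrBl dvdz_mulr.
exists a' => [i iI|].
  rewrite PoszM coprimezMr coprimez_prime // (coprimez_congr (aE i)) aP // andbT.
  rewrite /a'; case: ifPn => // pa; rewrite rpredDl //.
  rewrite -coprimez_prime // coprimez_sym.
  by have := aP _ iI; rewrite -(divzK pa) coprimezMl => /andP[].
rewrite (eq_bigr (fun i => p%:Z * (a' i * (x i %/ p)%Z))) => [|i iI].
  by rewrite -mulr_sumr PoszM dvdz_mul ?dvdzz.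
by rewrite mulrCA [p%:Z * _]mulrC divzK ?px.
Qed.

Definition has_weighted_zero_sum n m x D : Prop :=
  exists I : {set T}, [/\ I \subset D, #|I| = m & weighted_zero_sum n x I].

(** If every prime has two nonmultiples in [D], at most [2 * size ps] indices witness this, and
    padding them to [m] indices gives a zero-sum. *)
Lemma zero_sum_or_few_nonmultiples (ps : seq nat) m x D :
  all prime ps -> all odd ps -> (2 * size ps <= m <= #|D|)%N ->
  has_weighted_zero_sum (\prod_(p <- ps) p) m x D \/
  exists2 p, p \in ps & (#|nonmultiples p x D| <= 1)%N.
Proof.
move=> ps_prime ps_odd /andP[psm mD].
have [/hasP[p pps pD]|/hasPn psP] :=
    boolP (has (fun p => #|nonmultiples p x D| <= 1)%N ps).
  by right; exists p.
left; have [p pps|I [ID Isz IP]] := @exists_two_nonmultiples ps x D.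
  by rewrite ltnNge psP.
have [|J [IJ JD Jm]] := exists_subset_card (m := m) ID.
  by rewrite mD (leq_trans Isz).
exists J; split=> //; apply: weighted_zero_sum_two_nonmultiples.
  elim: ps ps_odd {psP IP Isz ps_prime psm} => [|p ps IH] /=.
    by rewrite big_nil.
  by rewrite big_cons oddM => /andP[-> /IH].
move=> q q_prime qn.
have qps : q \in ps.
  elim: ps ps_prime qn {psP IP Isz ps_odd psm} => [|p ps IH] /=.
    by rewrite big_nil dvdn1 => _ /eqP q1; rewrite q1 in q_prime.
  rewrite big_cons Euclid_dvdM // inE => /andP[p_prime /IH{}IH].
  case/orP=> [|/IH->]; last by rewrite orbT.
  by rewrite dvdn_prime2 // => ->.
exact: leq_trans (IP _ qps) (subset_leq_card (nonmultiplesS _ _ IJ)).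
Qed.

Lemma has_weighted_zero_sum_lift n m p x D E :
  prime p -> E \subset D -> (forall i, i \in E -> (p %| x i)%Z) ->
  has_weighted_zero_sum n m (fun i => (x i %/ p)%Z) E ->
  has_weighted_zero_sum (p * n) m x D.
Proof.
move=> p_prime ED px [I [IE Im I0]]; exists I; split=> //.
  exact: subset_trans ED.
by apply: weighted_zero_sum_lift => // i /(subsetP IE)/px.
Qed.

Lemma prod_rem (ps : seq nat) p :
  p \in ps -> (\prod_(q <- ps) q)%N = (p * \prod_(q <- rem p ps) q)%N.
Proof. by move=> pps; rewrite (perm_big _ (perm_to_rem pps)) big_cons. Qed.

(** Upper bound for the Gao constant. Each induction step removes one prime at the cost of at most
    one index; with no prime left, the second alternative of the dichotomy is void. *)
Lemma exists_weighted_zero_sum (ps : seq nat) m x D :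
  all prime ps -> all odd ps -> (2 * size ps <= m)%N ->
  (m + size ps <= #|D|)%N ->
  has_weighted_zero_sum (\prod_(p <- ps) p) m x D.
Proof.
move: {2}(size ps) (erefl (size ps)) => k.
elim: k => [|k IH] in ps x D * => psk ps_prime ps_odd psm psD.
all: have mD : (2 * size ps <= m <= #|D|)%N by move: psm psD; lia.
  have [//|[p]] := zero_sum_or_few_nonmultiples x ps_prime ps_odd mD.
  by rewrite (size0nil psk).
have [//|[p pps pD]] := zero_sum_or_few_nonmultiples x ps_prime ps_odd mD.
have p_prime := allP ps_prime _ pps.
rewrite (prod_rem pps).
apply: (has_weighted_zero_sum_lift p_prime (subsetDl D (nonmultiples p x D))).
  by move=> i; rewrite !inE => /andP[+ iD]; rewrite iD negbK.
have rem_sub := mem_rem (x := p) (s := ps).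
apply: IH; rewrite ?size_rem ?psk //.
- by apply/allP => q /rem_sub/(allP ps_prime).
- by apply/allP => q /rem_sub/(allP ps_odd).
- by rewrite psk in psm; lia.
- rewrite cardsD (setIidPr _); last by apply/subsetP => i; rewrite inE => /andP[].
  rewrite psk in psD; lia.
Qed.

(** Total functions on [nat] are used so that prepending a prime is a mere shift of the index. *)
Definition standard_entry (p : nat -> nat) (b : nat -> int) (i : nat) : int :=
  (\prod_(j < i) p j)%N%:Z * b i.

(** [D] is one index short of the bound that forces a zero-sum, so each step must discard exactly
    one index. [ts] lists the discarded indices in order; what is never discarded is divisible by
    every prime in turn, hence by the product. *)
Lemma zero_sum_free_structure (ps : seq nat) k m x D :
  size ps = k -> all prime ps -> all odd ps -> (2 * k <= m)%N ->
  (#|D|.+1 = m + k)%N ->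
  ~ has_weighted_zero_sum (\prod_(p <- ps) p) m x D ->
  exists (p : nat -> nat) (b : nat -> int) (ts : seq T),
    [/\ (\prod_(i < k) p i = \prod_(q <- ps) q)%N,
        forall i, (i < k)%N -> prime (p i) /\ coprimez (b i) (p i),
        uniq ts /\ {subset ts <= D},
        map x ts = mkseq (standard_entry p b) k
      & forall t, t \in D -> t \notin ts -> ((\prod_(q <- ps) q)%N %| x t)%Z].
Proof.
elim: k => [|k IH] in ps x D * => psk ps_prime ps_odd psm psD no_zs.
  exists id, (fun=> 0), [::]; split=> //.
    by rewrite (size0nil psk) big_nil big_ord0.
  by move=> t _ _; rewrite (size0nil psk) big_nil dvd1z.
have mD : (2 * size ps <= m <= #|D|)%N by rewrite psk psm; lia.
have [//|[p pps pD]] := zero_sum_or_few_nonmultiples x ps_prime ps_odd mD.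
have p_prime := allP ps_prime _ pps.
have rem_sub := mem_rem (x := p) (s := ps).
have rem_prime : all prime (rem p ps).
  by apply/allP => q /rem_sub/(allP ps_prime).
have rem_odd : all odd (rem p ps).
  by apply/allP => q /rem_sub/(allP ps_odd).
have rem_k : size (rem p ps) = k by rewrite size_rem ?psk.
(* If no index were discarded, the quotients by [p] over all of [D] would meet the bound for one
   prime fewer and yield a zero-sum. *)
have [N0|/cards1P[t Nt]] :
    #|nonmultiples p x D| = 0%N \/ #|nonmultiples p x D| == 1%N.
  by case: #|_| pD => [|[]] //; [left|right].
  case: no_zs; rewrite (prod_rem pps).
  apply: (has_weighted_zero_sum_lift p_prime (subxx D)) => [i iD|].
    move/eqP: N0; rewrite cards_eq0 => /eqP/setP/(_ i).
    by rewrite !inE iD => /negbFE.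
  by apply: exists_weighted_zero_sum; rewrite ?rem_k //; lia.
have /setIdP[tD pt] : t \in nonmultiples p x D by rewrite Nt set11.
have pE i : i \in D :\ t -> (p %| x i)%Z.
  rewrite !inE => /andP[it iD].
  by move/setP/(_ i): Nt; rewrite !inE iD (negPf it) => /negbFE.
have [||||||q [b [ts [qE qP [ts_uniq tsD] tsE tsN]]]] :=
    IH (rem p ps) (fun i => (x i %/ p)%Z) (D :\ t).
- by [].
- by [].
- by [].
- by lia.
- by move: (cardsD1 t D); rewrite tD; lia.
- move=> /(has_weighted_zero_sum_lift p_prime (subsetDl D [set t]) pE).
  by rewrite -prod_rem.
(* The prime [p] goes in front, with [b 0 = x t] prime to it; the entries obtained for the quotients
   are multiplied by [p] and shifted by one. *)
exists (fun i => if i is j.+1 then q j else p).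
exists (fun i => if i is j.+1 then b j else x t).
exists (t :: ts); split.
- by rewrite big_ord_recl /= qE (prod_rem pps).
- by case=> [_|i /qP//]; rewrite coprimez_prime.
- split=> [|i]; rewrite /= ?ts_uniq ?andbT.
    by apply/negP => /tsD; rewrite !inE eqxx.
  by rewrite inE => /orP[/eqP->//|/tsD]; rewrite inE => /andP[].
- rewrite /= /mkseq /= -add1n iotaDl -map_comp.
  rewrite /standard_entry big_ord0 mul1r; congr cons.
  rewrite (eq_in_map _ (fun i => p%:Z * (x i %/ p)%Z) ts).1; last first.
    by move=> i /tsD/pE pi; rewrite mulrC divzK.
  rewrite (map_comp (fun z : int => p%:Z * z)) tsE /mkseq -map_comp.
  apply: eq_map => i /=; rewrite /standard_entry add1n big_ord_recl /=.
  by rewrite PoszM mulrA.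
- move=> i iD; rewrite inE negb_or => /andP[it its].
  have iDt : i \in D :\ t by rewrite !inE it.
  by rewrite (prod_rem pps) PoszM mulrC -(divzK (pE i iDt)) dvdz_mul ?dvdzz ?tsN.
Qed.

End WeightedZeroSums.

(** * Standard sequences admit no weighted zero-sum *)

Lemma dvdn_prod_leq (p : nat -> nat) (k l : nat) :
  (k <= l)%N -> (\prod_(i < k) p i %| \prod_(i < l) p i)%N.
Proof.
elim: l => [|l IH]; first by rewrite leqn0 => /eqP->.
rewrite leq_eqVlt => /orP[/eqP->//|/IH kl].
by rewrite [X in (_ %| X)%N]big_ord_recr dvdn_mulr.
Qed.

(** [l] gives the position of an index in the sequence. The chosen term of least position is the
    only one not divisible by the product of the primes up to that position. *)
Lemma standard_not_weighted_zero_sum (T : finType) (k : nat) (p : nat -> nat)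
    (b : nat -> int) (x : T -> int) (l : T -> nat) (I : {set T}) (t0 : T) :
  (forall i, (i < k)%N -> prime (p i) /\ coprimez (b i) (p i)) ->
  injective l ->
  (forall t, (l t < k)%N -> x t = standard_entry p b (l t)) ->
  (forall t, (k <= l t)%N -> ((\prod_(i < k) p i)%N %| x t)%Z) ->
  t0 \in I -> (l t0 < k)%N -> ~ weighted_zero_sum (\prod_(i < k) p i) x I.
Proof.
move=> pP l_inj x_lt x_ge t0I t0k [a aP a0].
case: (arg_minnP l t0I) => t tI t_min.
have tk : (l t < k)%N by apply: leq_ltn_trans (t_min _ t0I) t0k.
have [pt_prime bt] := pP _ tk.
have P_dvd j : (l t < j)%N -> (j <= k)%N ->
    ((\prod_(i < (l t).+1) p i)%N %| (\prod_(i < j) p i)%N%:Z)%Z.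
  by move=> tj _; rewrite dvdzE dvdn_prod_leq.
(* Reduce modulo the product of the primes up to position [l t]: every other term vanishes. *)
have := dvdz_trans (P_dvd k tk (leqnn k)) a0.
rewrite (big_setD1 t tI) /= rpredDr; last first.
  rewrite rpred_sum // => i; rewrite !inE => /andP[it iI].
  have ti : (l t < l i)%N.
    by rewrite ltn_neqAle t_min // andbT eq_sym (inj_eq l_inj).
  rewrite dvdz_mull //; have [ik|ki] := ltnP (l i) k.
    by rewrite x_lt // dvdz_mulr // P_dvd // ltnW.
  exact: dvdz_trans (P_dvd k tk (leqnn k)) (x_ge _ ki).
(* Cancelling the earlier primes leaves [p (l t)] dividing [a t * b (l t)], although it is prime to
   both factors. *)
rewrite x_lt // /standard_entry big_ord_recr PoszM mulrCA dvdz_mul2l.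
  rewrite dvdz_prime_mul // -[_ || _]negbK negb_or -!coprimez_prime // bt.
  have := aP t tI; rewrite (bigD1 (Ordinal tk)) //= PoszM coprimezMr.
  by move=> /andP[->].
rewrite eqz_nat -lt0n; apply: prodn_gt0 => i.
by apply: prime_gt0; apply: (pP _ _).1; apply: ltn_trans tk.
Qed.

(** * Products of odd primes *)

Lemma odd_prod_primes (ps : seq nat) :
  odd (\prod_(p <- ps) p) -> all odd ps.
Proof.
by elim: ps => [|p ps IH] //=; rewrite big_cons oddM => /andP[-> /IH].
Qed.

(** Each odd prime is at least 3. This supplies the condition [2 * size ps <= m] for [m = n]. *)
Lemma double_size_le_prod (ps : seq nat) :
  all prime ps -> all odd ps -> (2 * size ps < \prod_(p <- ps) p)%N.
Proof.
elim: ps => [|p ps IH] /=; first by rewrite big_nil.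
move=> /andP[p_prime /IH{}IH] /andP[p_odd /IH{}IH]; rewrite big_cons.
have p_gt2 := odd_prime_gt2 p_odd p_prime.
by have := leq_mul p_gt2 IH; lia.
Qed.

(** * Transfer between integers and [Zmod n] *)

Section Zmod.

Variables (n : nat) (n_gt0 : (0 < n)%N).

Lemma val_natr_Zmod (m : nat) : \val (m%:R : Zmod n) = (m %% n)%N.
Proof.
elim: m => [|m IH]; first by rewrite mod0n.
rewrite mulrS /= IH prednK //.
by rewrite modnDml modnDmr add1n.
Qed.

Lemma intr_Zmod_eq0 (z : int) : (z%:~R == 0 :> Zmod n) = (n %| z)%Z.
Proof.
have nat_eq0 m : (m%:R == 0 :> Zmod n) = (n %| m)%N.
  by rewrite -val_eqE /= val_natr_Zmod.
case: z => m; first by rewrite dvdzE -nat_eq0.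
by rewrite NegzE rmorphN oppr_eq0 dvdzE -nat_eq0.
Qed.

Lemma Zmod_intr (x : Zmod n) : (\val x)%:Z%:~R = x.
Proof.
apply: val_inj; rewrite -pmulrn val_natr_Zmod modn_small //.
by case: x => /= m; rewrite prednK.
Qed.

(** Bezout relations modulo [n] are inverses. *)
Lemma intr_in_U (z : int) : (z%:~R \in U n) = coprimez z n.
Proof.
rewrite inE; apply/existsP/coprimezP => [[y]|[[y k] /= yk]].
  rewrite -{1}(Zmod_intr y) -subr_eq0 -intrM -[1]/(1%:~R) -intrB intr_Zmod_eq0.
  case/dvdzP => k zk; exists (\val y : int, - k) => /=.
  by rewrite mulNr -zk; ring.
exists y%:~R; rewrite -subr_eq0 -intrM -[1]/(1%:~R) -intrB intr_Zmod_eq0 -yk.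
by rewrite mulrC opprD addrA subrr sub0r dvdzE abszN -dvdzE dvdz_mull.
Qed.

Lemma U_mul (x y : Zmod n) : x \in U n -> y \in U n -> x * y \in U n.
Proof.
rewrite !inE => /existsP[x' /eqP xx'] /existsP[y' /eqP yy'].
by apply/existsP; exists (x' * y'); rewrite mulrACA xx' yy' mulr1.
Qed.

Lemma U_inv (x : Zmod n) : x \in U n -> exists2 y, y \in U n & x * y = 1.
Proof.
rewrite inE => /existsP[y /eqP xy]; exists y => //.
by rewrite inE; apply/existsP; exists x; rewrite mulrC xy.
Qed.

(* The index type is ['I_l] for a variable [l] so that sequences of equal
   lengths can share it. *)
Lemma has_zero_sum_subseqE (A : {set Zmod n}) (s : seq (Zmod n)) (l : nat) :
  size s = l ->
  has_zero_sum_subseq_of_length A s n <->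
  exists (I : {set 'I_l}) (a : 'I_l -> Zmod n),
    [/\ #|I| = n, forall i, i \in I -> a i \in A & \sum_(i in I) a i * s`_i = 0].
Proof.
move=> sl; subst l; split=> [[I [I0 [a aA a0]] In]|[I [a [In aA a0]]]].
  by exists I, a.
exists I => //; split; last by exists a.
by rewrite -card_gt0 In.
Qed.

(** Any integer lift [x] of the terms may be used; weights pass to residues one way and to canonical
    representatives the other way. *)
Lemma has_zero_sum_subseqP (s : seq (Zmod n)) (l : nat) (x : 'I_l -> int) :
  size s = l -> (forall i, (x i)%:~R = s`_i) ->
  has_zero_sum_subseq_of_length (U n) s n <-> has_weighted_zero_sum n n x setT.
Proof.
move=> sl xE; split.
  move=> /(has_zero_sum_subseqE _ sl)[I [a [In aU a0]]].
  exists I; split; rewrite ?subsetT //.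
  exists (fun i => \val (a i)) => [i /aU|].
    by rewrite -{1}(Zmod_intr (a i)) intr_in_U.
  rewrite -intr_Zmod_eq0 rmorph_sum -[X in _ == X]a0; apply/eqP/eq_bigr => i _.
  by rewrite rmorphM /= Zmod_intr xE.
case=> I [_ In [a aU a0]]; apply/(has_zero_sum_subseqE _ sl).
exists I, (fun i => (a i)%:~R); split=> // [i /aU|]; first by rewrite intr_in_U.
move: a0; rewrite -intr_Zmod_eq0 rmorph_sum => /eqP a0; rewrite -[RHS]a0.
by apply: eq_bigr => i _; rewrite rmorphM /= xE.
Qed.

Lemma has_zero_sum_subseq_equiv (x y : seq (Zmod n)) :
  seq_equiv (U n) x y -> has_zero_sum_subseq_of_length (U n) x n ->
  has_zero_sum_subseq_of_length (U n) y n.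
Proof.
move=> [xy [c [sigma [u [cU uU xyE]]]]].
move=> /(has_zero_sum_subseqE _ erefl)[I [a [In aU a0]]].
apply/(has_zero_sum_subseqE _ (esym xy)).
have uU' i : exists v, (v \in U n) && (u i * v == 1).
  by have [v vU /eqP uv] := U_inv (uU i); exists v; rewrite vU.
pose v i := xchoose (uU' i).
have vU i : v i \in U n by have /andP[] := xchooseP (uU' i).
have uv i : u i * v i = 1 by have /andP[_ /eqP] := xchooseP (uU' i).
(* From [c * y_(sigma i) = u i * x_i], with [v i] inverse to [u i], the term [a i * x_i] equals
   [a i * v i * c * y_(sigma i)]. *)
exists (sigma @: I), (fun j => let i := (sigma^-1)%g j in a i * v i * c).
split=> [|_ /imsetP[i iI ->]|].
- by rewrite card_imset //; apply: perm_inj.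
- by rewrite /= permK !U_mul // aU.
rewrite big_imset /=; last by move=> i j _ _; apply: perm_inj.
rewrite -[RHS]a0; apply: eq_bigr => i _.
rewrite permK -mulrA xyE mulrA -[a i * v i * u i]mulrA.
by rewrite [v i * u i]mulrC uv mulr1.
Qed.

Lemma has_zero_sum_subseq_take (A : {set Zmod n}) (s : seq (Zmod n)) (j : nat) :
  has_zero_sum_subseq_of_length A (take j s) n ->
  has_zero_sum_subseq_of_length A s n.
Proof.
move=> /(has_zero_sum_subseqE _ erefl)[I [a [In aA a0]]].
have js : (size (take j s) <= size s)%N by rewrite size_take_min geq_minr.
apply/(has_zero_sum_subseqE _ erefl).
have w_inj : injective (widen_ord js) by move=> i i' /(congr1 val) /= /ord_inj.
exists (widen_ord js @: I).
(* The default weight 0 occurs only beyond the prefix, outside the chosen index set. *)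
exists (fun i => oapp a 0 (insub (\val i))); split=> [|_ /imsetP[i iI ->]|].
- by rewrite card_imset.
- by rewrite /= valK aA.
rewrite big_imset /=; last by move=> i i' _ _; apply: w_inj.
rewrite -[RHS]a0; apply: eq_bigr => i _; rewrite valK nth_take //.
by apply: leq_trans (ltn_ord i) _; rewrite size_take_min geq_minl.
Qed.

Lemma perm_seq_equiv (x y : seq (Zmod n)) : perm_eq x y -> seq_equiv (U n) x y.
Proof.
move=> xy; have sz := perm_size xy; split=> //.
have /tuple_permP[sigma sE] : perm_eq x (Tuple (introT eqP (esym sz))) by [].
have U1 : 1 \in U n by rewrite inE; apply/existsP; exists 1; rewrite mulr1.
exists 1, sigma, (fun=> 1); split=> // i; rewrite !mul1r.
pose f j := tnth (Tuple (introT eqP (esym sz))) (sigma j).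
have -> : y`_(sigma i) = f i by rewrite /f (tnth_nth 0).
by rewrite -(tnth_mktuple f i) (tnth_nth 0) -sE.
Qed.

(** Links families indexed by ['I_k] to any extensions of them to [nat]. *)
Lemma standard_seqE (k : nat) (p : 'I_k -> nat) (b : 'I_k -> int)
    (p' : nat -> nat) (b' : nat -> int) :
  (forall i : 'I_k, p' i = p i) -> (forall i : 'I_k, b' i = b i) ->
  standard_seq n p b =
  map intr (mkseq (standard_entry p' b') k) ++ nseq (n - 1) 0.
Proof.
move=> pE bE; congr (_ ++ _); rewrite /mkseq -val_enum_ord -!map_comp.
apply: eq_map => i /=; rewrite /standard_entry bE.
have -> : (\prod_(j < i) p' j = \prod_(j < k | (j < i)%N) p j)%N.
  rewrite (big_ord_widen k p' (ltnW (ltn_ord i))).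
  by apply: eq_bigr => j _; apply: pE.
by [].
Qed.

Lemma size_standard_seq (k : nat) (p : 'I_k -> nat) (b : 'I_k -> int) :
  size (standard_seq n p b) = (k + (n - 1))%N.
Proof. by rewrite size_cat size_map size_enum_ord size_nseq. Qed.

Lemma standard_seq_zero_sum_free (k : nat) (p : 'I_k -> nat) (b : 'I_k -> int) :
  (forall i, prime (p i)) -> n = (\prod_(i < k) p i)%N ->
  (forall i, coprimez (b i) (p i)) ->
  ~ has_zero_sum_subseq_of_length (U n) (standard_seq n p b) n.
Proof.
move=> p_prime nE b_co.
pose p' j := oapp p 0%N (insub j); pose b' j := oapp b 0 (insub j).
have p'E (i : 'I_k) : p' i = p i by rewrite /p' valK.
have b'E (i : 'I_k) : b' i = b i by rewrite /b' valK.
have nE' : n = (\prod_(i < k) p' i)%N by rewrite nE; apply: eq_bigr.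
pose x (i : 'I_(k + (n - 1))) := if (i < k)%N then standard_entry p' b' i else 0.
have xE i : (x i)%:~R = (standard_seq n p b)`_i.
  rewrite (standard_seqE p'E b'E) nth_cat size_map size_mkseq /x.
  case: ltnP => ik; last by rewrite nth_nseq if_same.
  by rewrite (nth_map 0) ?size_mkseq // nth_mkseq.
move=> /(has_zero_sum_subseqP (size_standard_seq p b) xE)[I [_ In I0]].
(* Pigeonhole: [n] indices cannot all lie among the [n - 1] trailing zeros. *)
have [t0 t0I t0k] : exists2 t, t \in I & (t < k)%N.
  apply/exists_inP; apply: contraT; rewrite negb_exists_in => /forall_inP I_ge.
  have : (#|I| <= #|[set rshift k j | j : 'I_(n - 1)]|)%N.
    apply/subset_leq_card/subsetP => i iI; apply/imsetP.
    have := I_ge _ iI; rewrite -leqNgt => ki.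
    have ik : (i - k < n - 1)%N by move: (ltn_ord i); lia.
    by exists (Ordinal ik) => //; apply: val_inj; rewrite /= subnKC.
  by rewrite card_imset ?card_ord ?In; [lia | apply: rshift_inj].
apply: (@standard_not_weighted_zero_sum _ k p' b' x val I t0) => //.
- by move=> i ik; have := p'E (Ordinal ik); have := b'E (Ordinal ik) => /= -> ->.
- exact: val_inj.
- by move=> t tk; rewrite /x tk.
- by move=> t; rewrite /x leqNgt => /negPf->; rewrite dvdz0.
by rewrite -nE'.
Qed.

(** * The value of the Gao constant *)

(** Here [size ps] is the number of prime factors of [n] with multiplicity. For minimality, a
    standard sequence of length [n + size ps - 1] is truncated to any smaller length. *)
Lemma gao_constantE (ps : seq nat) :
  odd n -> all prime ps -> n = (\prod_(p <- ps) p)%N ->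
  is_gao_constant (U n) (n + size ps).
Proof.
move=> n_odd ps_prime nE.
have ps_odd : all odd ps by apply: odd_prod_primes; rewrite -nE.
split=> [|s s_size|j j_gt0 jP]; first by rewrite addn_gt0 n_gt0.
  apply/(has_zero_sum_subseqP (x := fun i => \val s`_i) s_size) => [i|].
    exact: Zmod_intr.
  suff : has_weighted_zero_sum (\prod_(p <- ps) p) n
      (fun i : 'I_(n + size ps) => \val s`_i) setT by rewrite -nE.
  apply: exists_weighted_zero_sum; rewrite ?cardsT ?card_ord //.
  by rewrite nE ltnW // double_size_le_prod.
rewrite leqNgt; apply/negP => j_lt.
pose p (i : 'I_(size ps)) := nth 0%N ps i.
have pE : n = (\prod_(i < size ps) p i)%N by rewrite nE (big_nth 0%N) big_mkord.
(* Taking every [b i] equal to 1 gives a sequence refuting the Gao property at [j]. *)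
apply: (@standard_seq_zero_sum_free _ p (fun=> 1)) => //.
- by move=> i; apply: (allP ps_prime); rewrite mem_nth.
- by move=> i; rewrite coprimezE /= coprime1n.
apply: (@has_zero_sum_subseq_take _ _ j); apply: jP.
by rewrite size_takel // size_standard_seq; lia.
Qed.

Lemma gao_constant_unique (A : {set Zmod n}) (k l : nat) :
  is_gao_constant A k -> is_gao_constant A l -> k = l.
Proof.
move=> [k0 kP kmin] [l0 lP lmin].
by apply/eqP; rewrite eqn_leq kmin ?lmin.
Qed.

Lemma prime_factorization :
  exists2 ps : seq nat, all prime ps & n = (\prod_(p <- ps) p)%N.
Proof.
elim/ltn_ind: n n_gt0 => m IH m_gt0.
have [m1|m_gt1] := leqP m 1.
  by exists [::]; rewrite // big_nil; case: m m1 m_gt0 {IH} => [|[]].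
have p_prime := pdiv_prime m_gt1; have pm := pdiv_dvd m.
have [||ps ps_prime mE] := IH (m %/ pdiv m)%N.
- by rewrite ltn_Pdiv ?prime_gt1.
- by rewrite divn_gt0 ?prime_gt0 ?pdiv_leq.
by exists (pdiv m :: ps); rewrite /= ?p_prime // big_cons -mE mulnC divnK.
Qed.

End Zmod.

(** * Characterization of the extremal sequences *)

Theorem theorem1 (n : nat) (n_odd : odd n) (S : seq (Zmod n)) :
  gao_extremal (U n) S <->
  exists (k : nat) (p : 'I_k -> nat) (b : 'I_k -> int),
    [/\ forall i, prime (p i),
        n = (\prod_(i < k) p i)%N,
        forall i, coprimez (b i) (p i)%:Z
      & seq_equiv (U n) S (standard_seq n p b)].
Proof.
have n_gt0 : (0 < n)%N by case: (n) n_odd.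
split=> [[k0 [k0P S_size S_free]]|[k [p [b [p_prime nE b_co SE]]]]]; last first.
  (* A standard sequence has the extremal length and no zero-sum, and both properties pass to [S]
     through the equivalence. *)
  pose ps := [seq p i | i <- enum 'I_k].
  have ps_k : size ps = k by rewrite size_map size_enum_ord.
  exists (n + k)%N; split.
  - rewrite -ps_k; apply: gao_constantE => //.
      by apply/allP => _ /mapP[i _ ->].
    by rewrite big_map big_enum.
  - by case: SE => -> _; rewrite size_standard_seq; lia.
  - move=> /(has_zero_sum_subseq_equiv n_gt0 SE).
    exact: standard_seq_zero_sum_free.
have [ps ps_prime nE] := prime_factorization n_gt0.
have k0E := gao_constant_unique k0P (gao_constantE n_gt0 n_odd ps_prime nE).
have ps_odd : all odd ps by apply: odd_prod_primes; rewrite -nE.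
pose x (i : 'I_(size S)) : int := \val S`_i.
have xE i : (x i)%:~R = S`_i by apply: Zmod_intr.
(* The structure result applies to all indices of [S], since [size S + 1 = n + size ps]. *)
have [||||||p [b [ts [pE pP [ts_uniq _] tsE tsN]]]] :=
    @zero_sum_free_structure _ ps (size ps) n x setT.
- by [].
- by [].
- by [].
- by rewrite nE ltnW // double_size_le_prod.
- by rewrite cardsT card_ord S_size k0E; lia.
- by rewrite -nE => /(has_zero_sum_subseqP n_gt0 erefl xE).
exists (size ps), (fun i => p i), (fun i => b i); split.
- by move=> i; case: (pP i).
- by rewrite pE.
- by move=> i; case: (pP i).
(* A permutation suffices: [ts] carries the first block, and the [n - 1] other indices carry
   multiples of [n], that is, zeros. *)
apply: perm_seq_equiv; rewrite (@standard_seqE n _ _ _ p b) // -tsE.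
have SE : S = [seq S`_(\val i) | i <- enum 'I_(size S)].
  by rewrite -[LHS](mkseq_nth 0) /mkseq -val_enum_ord -map_comp.
pose r := [seq i <- enum 'I_(size S) | i \notin ts].
have tsr : perm_eq (enum 'I_(size S)) (ts ++ r).
  apply: uniq_perm; first exact: enum_uniq.
    rewrite cat_uniq ts_uniq filter_uniq ?enum_uniq // andbT.
    by apply/hasPn => i; rewrite mem_filter => /andP[].
  by move=> i; rewrite mem_enum mem_cat (mem_filter _ i) mem_enum andbT orbN.
have rE : [seq S`_(\val i) | i <- r] = nseq (n - 1) 0.
  have -> : (n - 1)%N = size [seq S`_(\val i) | i <- r].
    have := perm_size tsr; rewrite size_enum_ord size_cat -(size_map x ts) tsE.
    rewrite size_mkseq size_map => sz; apply: (@addnI (size ps)).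
    by apply: etrans sz; rewrite S_size k0E; lia.
  apply/all_pred1P/allP => z /mapP[i]; rewrite mem_filter => /andP[its _] ->.
  by rewrite /= -xE intr_Zmod_eq0 // nE tsN ?inE.
rewrite {1}SE (perm_trans (perm_map _ tsr)) // map_cat rE -map_comp.
have -> : [seq S`_(\val i) | i <- ts] = [seq (x i)%:~R | i <- ts].
  by apply: eq_map => i; rewrite xE.
exact: perm_refl.
Qed.
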